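(* Let $(Q,* )$ be a finite quandle, $A$ a finite abelian group, $\psi:Q\times Q\to A$ a quandle 2-cocycle, $\mathbb k=\mathbb Z[A]$, $V$ the free $\mathbb k$-module generated by $Q$, $R(x\otimes y)=y\otimes(x*y)$, and $\phi(x\otimes y)=\psi(x,y)\cdot R(x\otimes y)$ for $x,y\in Q$. Let $\Phi_\phi(K)=\Phi^0_\phi(K)+\hbar\Phi^1_\phi(K)$ be the quantum cocycle invariant of an oriented knot or link $K$ obtained via traces from the enhanced Yang--Baxter operator $(R+\hbar\phi,1,1,\mathbb 1)$, and let $D$ be a diagram of $K$. Then $$\Phi^1_\phi(K)=\sum_{\mathcal C\in\mathrm{Col}_Q(D)}\sum_u\epsilon(u)\,\psi(x_u,y_u),$$ where $u$ runs over the crossings of $D$ and both summations are taken in $\mathbb k=\mathbb Z[A]$. Thus $$\Phi_\phi(K)=\Phi^0_\phi(K)+\hbar\Phi^1_\phi(K)=|\mathrm{Col}_Q(D)|+\hbar\sum_{\mathcal C\in\mathrm{Col}_Q(D)}\sum_u\epsilon(u)\,\psi(x_u,y_u),$$ where $|\mathrm{Col}_Q(D)|$ denotes the number of colorings of $D$ by $Q$.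
   Context: $\mathbb Z[A]$ is the group ring of $A$; the values of $\psi$ are regarded as elements of $\mathbb Z[A]$ when used as scalars, and sums of them are taken with the addition of the group ring. A quandle is a set $Q$ with an idempotent operation $*$ such that every right translation $x\mapsto x*y$ is a $*$-automorphism. A quandle 2-cocycle with coefficient group $A$ is a function $\psi:Q\times Q\to A$ with (in additive notation for $A$) $\psi(x,y)+\psi(x*y,z)-\psi(x,z)-\psi(x*z,y*z)=0$ for all $x,y,z\in Q$; moreover $\psi(x,x)=0$ for all $x\in Q$. Colorings: a coloring $\mathcal C$ of an oriented diagram $D$ by $Q$ assigns an element of $Q$ to each arc (arcs are broken at under-crossings) so that at each crossing, if the over-arc has color $y$ and the under-arc lying to the right of the oriented over-arc has color $x$, then the under-arc lying to its left has color $x*y$. For a crossing $u$ the pair $(x,y)$ is denoted $(x_u,y_u)$ (it depends on $\mathcal C$), and $\epsilon(u)=\pm1$ is the sign of $u$. $\mathrm{Col}_Q(D)$ is the set of colorings. (For a braid oriented downwards, a positive crossing with top colors $(x,y)$ has bottom colors $(y,x*y)$, in agreement with $R$.) Invariant: an enhanced Yang--Baxter operator is a quadruple $(\tilde R,\alpha,\beta,\tilde\mu)$ where $\tilde R$ is invertible, satisfies $(\tilde R\otimes\mathbb 1)(\mathbb 1\otimes\tilde R)(\tilde R\otimes\mathbb 1)=(\mathbb 1\otimes\tilde R)(\tilde R\otimes\mathbb 1)(\mathbb 1\otimes\tilde R)$ and commutes with $\tilde\mu\otimes\tilde\mu$, $\alpha,\beta$ are invertible scalars, and $\mathrm{Tr}_2(\tilde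 R^{\pm1}(\tilde\mu\otimes\tilde\mu))=\alpha^{\pm1}\beta\tilde\mu$, with $\mathrm{Tr}_2$ the partial trace over the second factor. Here it is $(\tilde R,1,1,\mathbb 1)$ with $\tilde R=R+\hbar\phi$ on $\tilde V=\mathbb k[[\hbar]]/(\hbar^2)\otimes V$. If $K$ is the closure of an $m$-braid $b_m$, and $\Psi_\phi(b_m)$ is the operator on $\tilde V^{\otimes m}$ obtained from $\sigma_i^{\pm1}\mapsto\mathbb 1^{\otimes(i-1)}\otimes\tilde R^{\pm1}\otimes\mathbb 1^{\otimes(m-i-1)}$ ($\sigma_i$ a positive crossing), then $\Phi_\phi(K)=\mathrm{Tr}(\Psi_\phi(b_m))\in\mathbb k[[\hbar]]/(\hbar^2)$, with $\Phi^0_\phi,\Phi^1_\phi\in\mathbb k$ its $\hbar^0$ and $\hbar^1$ coefficients.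
   Formalization: As ψ(x,x)=0 is the unit of Z[A], Tr_2(R+ħφ)=1+ħ, so Φ_φ(K) depends on the braid; the formula is proved for a braid whose closure is related to D by planar isotopy and Reidemeister II moves, or for every D of K if the operator is an enhanced Yang–Baxter operator (only empty Q). *)

(* Defs.v *)
From HB Require Import structures.
From mathcomp Require Import all_boot all_order all_algebra all_fingroup.
From mathcomp Require Import qpoly.
From Stdlib Require Import Relation_Operators.

Set Implicit Arguments.
Unset Strict Implicit.
Unset Printing Implicit Defensive.

Import GRing.Theory.
Local Open Scope ring_scope.

Record quandle := Quandle {
  quandle_sort :> finType;
  qop : quandle_sort -> quandle_sort -> quandle_sort;
  qop_idem : forall x, qop x x = x;
  qop_bij : forall y, bijective (qop^~ y);
  qop_dist : forall x y z, qop (qop x y) z = qop (qop x z) (qop y z) }.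

Definition quandle_cocycle (Q : quandle) (A : zmodType) (psi : Q -> Q -> A) :=
  (forall x y z,
     psi x y + psi (qop x y) z - psi x z - psi (qop x z) (qop y z) = 0) /\
  (forall x, psi x x = 0).

(* Z[A] as integer-valued functions on the additive group A, with convolution
   as product. *)

Definition group_ring (A : finZmodType) := {ffun A -> int}.
HB.instance Definition _ (A : finZmodType) := GRing.Zmodule.on (group_ring A).

Section GroupRing.
Variable A : finZmodType.
Implicit Types f g h : group_ring A.

Definition gr_elt (a : A) : group_ring A := [ffun b => (b == a)%:R].

Definition gr_mul f g : group_ring A := [ffun c => \sum_a f a * g (c - a)].

Fact gr_mulC : commutative gr_mul.
Proof.
move=> f g; apply/ffunP=> c; rewrite !ffunE.
rewrite (reindex_inj (inv_inj (subKr c))) /=.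
by apply: eq_bigr => a _; rewrite subKr mulrC.
Qed.

Fact gr_mulA : associative gr_mul.
Proof.
move=> f g h; apply/ffunP=> d; rewrite !ffunE.
under eq_bigr do rewrite ffunE mulr_sumr.
under [RHS]eq_bigr do rewrite ffunE mulr_suml.
rewrite [RHS]exchange_big /=; apply: eq_bigr => a _.
rewrite [RHS](reindex_inj (addIr a)) /=; apply: eq_bigr => b _.
by rewrite addrK mulrA opprD addrA addrAC.
Qed.

Fact gr_mul1 : left_id (gr_elt 0) gr_mul.
Proof.
move=> f; apply/ffunP=> c; rewrite ffunE (bigD1 0) //= ffunE eqxx mul1r subr0.
by rewrite big1 ?addr0 // => a /negPf a0; rewrite ffunE a0 mul0r.
Qed.

Fact gr_mulDl : left_distributive gr_mul +%R.
Proof.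
move=> f g h; apply/ffunP=> c; rewrite !ffunE -big_split /=.
by apply: eq_bigr => a _; rewrite ffunE mulrDl.
Qed.

Fact gr_nontrivial : gr_elt 0 != 0.
Proof. by apply/eqP=> /ffunP/(_ 0); rewrite !ffunE eqxx. Qed.

HB.instance Definition _ := GRing.Zmodule_isComNzRing.Build (group_ring A)
  gr_mulA gr_mulC gr_mul1 gr_mulDl gr_nontrivial.

End GroupRing.

(* An endomorphism of the free K-module with finite basis B is a matrix whose
   row b lists the coordinates of the image of the basis vector b. As matrices
   act on row vectors, M *m N is "first M, then N". The tensor power
   V^{(x) m.+1} of the free module V on W has basis {ffun 'I_m.+1 -> W}, and
   V (x) V has basis W * W. *)

Definition op_of (K : nzRingType) (B : finType) (F : B -> B -> K) : 'M[K]_#|B| :=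
  \matrix_(i, j) F (enum_val i) (enum_val j).

Definition entry (K : nzRingType) (B : finType) (M : 'M[K]_#|B|) (a b : B) : K :=
  M (enum_rank a) (enum_rank b).

Definition left_strand m (i : 'I_m) : 'I_m.+1 := widen_ord (leqnSn m) i.
Definition right_strand m (i : 'I_m) : 'I_m.+1 := lift ord0 i.

Definition mutual_inverses (K : nzRingType) n (M N : 'M[K]_n) : bool :=
  (M *m N == 1%:M) && (N *m M == 1%:M).

Section Operators.
Variables (K : comNzRingType) (W : finType).

(* 1^{(x) i} (x) T (x) 1^{(x) (m - 1 - i)} on m.+1 factors. *)
Definition op_at m (i : 'I_m) (T : 'M[K]_#|{: W * W}|) :
    'M[K]_#|{: {ffun 'I_m.+1 -> W}}| :=
  let l := left_strand i in let r := right_strand i in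
  op_of (fun x y : {ffun 'I_m.+1 -> W} =>
    entry T (x l, x r) (y l, y r) *
    [forall j, [|| j == l, j == r | x j == y j]]%:R).

Definition tensor_square (mu : 'M[K]_#|W|) : 'M[K]_#|{: W * W}| :=
  op_of (fun p q : W * W => entry mu p.1 q.1 * entry mu p.2 q.2).

Definition partial_trace2 (T : 'M[K]_#|{: W * W}|) : 'M[K]_#|W| :=
  op_of (fun a c : W => \sum_b entry T (a, b) (c, b)).

Definition enhanced_Yang_Baxter
    (T : 'M[K]_#|{: W * W}|) (alpha beta : K) (mu : 'M[K]_#|W|) : Prop :=
  exists (T' : 'M[K]_#|{: W * W}|) (alpha' beta' : K),
    let s1 := op_at (ord0 : 'I_2) T in
    let s2 := op_at (ord_max : 'I_2) T in
    let mu2 := tensor_square mu in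
    [/\ [/\ mutual_inverses T T', alpha * alpha' = 1 & beta * beta' = 1],
        s1 *m s2 *m s1 = s2 *m s1 *m s2,
        mu2 *m T = T *m mu2,
        partial_trace2 (mu2 *m T) = (alpha * beta) *: mu
      & partial_trace2 (mu2 *m T') = (alpha' * beta) *: mu].

End Operators.

Notation dual k := {poly %/ ('X^2 : {poly k})}.

Definition hbar (k : comNzRingType) : dual k := 'qX.

Section DeformedOperator.
Variables (Q : quandle) (A : finZmodType) (psi : Q -> Q -> A).
Local Notation k := (group_ring A).

Definition R_op : 'M[k]_#|{: Q * Q}| :=
  op_of (fun p q : Q * Q => (q == (p.2, qop p.1 p.2))%:R).

Definition phi_op : 'M[k]_#|{: Q * Q}| :=
  op_of (fun p q : Q * Q => gr_elt (psi p.1 p.2) * entry R_op p q).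

Definition Rtilde : 'M[dual k]_#|{: Q * Q}| :=
  map_mx (qpolyC 'X^2) R_op + hbar k *: map_mx (qpolyC 'X^2) phi_op.

Lemma Rtilde_invertible : exists T, mutual_inverses Rtilde T.
Proof.
pose C := qpolyC ('X^2 : {poly k}).
pose s (p : Q * Q) := (p.2, qop p.1 p.2).
have s_inj : injective s.
  move=> [x y] [x' y'] [/= <-] /(bij_inj (qop_bij y)) <- //.
have hh : hbar k * hbar k = 0.
  apply/val_inj/(etrans (poly_of_qpolyM _ _)).
  have -> : hbar k = 'X :> {poly k} by rewrite qpolyXE ?size_polyXn ?monicXn.
  transitivity (0 : {poly k}) => //.
  by rewrite mk_monic_Xn -expr2 Pdiv.RingMonic.rmodpp ?monicXn.
pose e (p : Q * Q) := hbar k * C (gr_elt (psi p.1 p.2)).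
have ee p : (1 + e p) * (1 - e p) = 1.
  rewrite mulrDl mul1r mulrBr mulr1 addrA subrK.
  by rewrite /e mulrACA hh mul0r subr0.
have RE i j : Rtilde i j =
    (1 + e (enum_val i)) * (enum_val j == s (enum_val i))%:R.
  rewrite !mxE /entry mxE !enum_rankK qpolyCM !rmorph_nat.
  by rewrite mulrA mulrDl mul1r.
exists (\matrix_(i, j)
  ((1 - e (enum_val j)) * (enum_val i == s (enum_val j))%:R)).
have [s' sK s'K] := injF_bij s_inj.
apply/andP; split; apply/eqP/matrixP=> i j; rewrite !mxE.
- rewrite (bigD1 (enum_rank (s (enum_val i)))) //= big1 ?addr0 => [|l].
    rewrite RE !mxE enum_rankK eqxx mulr1 (inj_eq s_inj) (inj_eq enum_val_inj).
    by case: eqP => [->|_]; rewrite ?mulr1 ?ee ?mulr0.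
  rewrite RE -(inj_eq enum_val_inj) enum_rankK => /negPf ->.
  by rewrite mulr0 mul0r.
- rewrite (bigD1 (enum_rank (s' (enum_val i)))) //= big1 ?addr0 => [|l].
    rewrite RE !mxE enum_rankK s'K eqxx mulr1 mulrA [_ * (1 + _)]mulrC ee mul1r.
    by rewrite (inj_eq enum_val_inj) eq_sym.
  rewrite -(inj_eq enum_val_inj) enum_rankK mxE => ls'.
  have /negPf -> : enum_val i != s (enum_val l).
    by apply: contraNneq ls' => ->; rewrite sK.
  by rewrite mulr0 mul0r.
Qed.

Definition Rtilde_inv : 'M[dual k]_#|{: Q * Q}| := xchoose Rtilde_invertible.

End DeformedOperator.

(* A braid on m.+1 strands is given by a word: (i, true) is the positive
   generator crossing strands i and i + 1 and (i, false) its inverse. Words are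
   read from the top of the downward oriented braid to its bottom. *)

Definition braid_word m := seq ('I_m * bool).

Section Invariant.
Variables (Q : quandle) (A : finZmodType) (psi : Q -> Q -> A).
Local Notation k := (group_ring A).

Fixpoint Psi_op m (w : braid_word m) :
    'M[dual k]_#|{: {ffun 'I_m.+1 -> Q}}| :=
  if w is (i, pos) :: w' then
    op_at i (if pos then Rtilde psi else Rtilde_inv psi) *m Psi_op w'
  else 1%:M.

Definition Phi m (w : braid_word m) : dual k := \tr (Psi_op w).
Definition Phi0 m (w : braid_word m) : k := (Phi w : {poly k})`_0.
Definition Phi1 m (w : braid_word m) : k := (Phi w : {poly k})`_1.

End Invariant.

(* The nodes are the passages of the strands through the crossings together
   with bivalent points subdividing the strands (as the vertices of a polygonal
   diagram do), so that a circle without crossings is a cycle of bivalent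
   nodes. next follows the orientation; every node x determines the edge from
   x to next x. The data describe a diagram on the sphere, forgetting only the
   relative position of its connected components, which does not affect the
   link. *)

Record diagram := Diagram {
  node : finType;
  crossing : finType;
  over : crossing -> node;
  under : crossing -> node;
  positive : crossing -> bool;
  next : {perm node};
  over_inj : injective over;
  under_inj : injective under;
  over_neq_under : forall c c', over c != under c' }.

Section Diagrams.
Variable D : diagram.

Definition bivalent (x : node D) : bool :=
  (x \notin codom (@over D)) && (x \notin codom (@under D)).

(* A dart (x, true) is the end of the edge x at the node x, and (x, false) is
   the end at x of the edge arriving at x. *)

Definition dart := (node D * bool)%type.

Definition opposite (d : dart) : dart :=
  if d.2 then (next D d.1, false) else ((next D)^-1%g d.1, true).

(* The counterclockwise cyclic order of the darts around a crossing is
   over-in, under-in, over-out, under-out if the crossing is positive, and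
   over-in, under-out, over-out, under-in if it is negative. *)
Definition rotate (d : dart) : dart :=
  let: (x, out) := d in
  match [pick c | over c == x], [pick c | under c == x] with
  | Some c, _ => (under c, if positive c then out else ~~ out)
  | None, Some c => (over c, if positive c then ~~ out else out)
  | None, None => (x, ~~ out)
  end.

Definition face (d : dart) : dart := rotate (opposite d).

(* Euler's formula: every connected component lies on a sphere, that is
   #vertices - #edges + #faces = 2 #components. Here #edges = #|node D| and
   #vertices = #|node D| - #|crossing D|. *)
Definition planar : bool :=
  fcard face predT ==
  (#|crossing D| +
   2 * n_comp [rel d d' | (d' == opposite d) || (d' == rotate d)] predT)%N.

(* Consecutive edges lie on the same arc unless separated by an
   under-passage. *)
Definition same_arc : rel (node D) :=
  connect [rel x y | (y == next D x) && (y \notin codom (@under D))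
                  || (x == next D y) && (x \notin codom (@under D))].

Definition arc_set (x : node D) : {set node D} := [set y | same_arc x y].

Definition arc_type := {a : {set node D} | a \in [set arc_set x | x : node D]}.

Definition arc_of (x : node D) : arc_type :=
  exist _ (arc_set x) (imset_f arc_set (isT : x \in node D)).

Definition over_arc (c : crossing D) : arc_type := arc_of (over c).
Definition under_in (c : crossing D) : arc_type := arc_of ((next D)^-1%g (under c)).
Definition under_out (c : crossing D) : arc_type := arc_of (under c).

(* The under-arcs to the right and to the left of the oriented over-arc. *)
Definition right_arc c := if positive c then under_in c else under_out c.
Definition left_arc c := if positive c then under_out c else under_in c.

Definition colorings (Q : quandle) : {set {ffun arc_type -> Q}} :=
  [set C : {ffun arc_type -> Q} |
    [forall c, C (left_arc c) == qop (C (right_arc c)) (C (over_arc c))]].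

Definition cocycle_sum (Q : quandle) (A : finZmodType) (psi : Q -> Q -> A) :
    group_ring A :=
  \sum_(C in colorings Q) \sum_(u : crossing D)
    (if positive u then 1 else -1) *
    gr_elt (psi (C (right_arc u)) (C (over_arc u))).

Definition with_next (s : {perm node D}) : diagram :=
  Diagram (@positive D) s (@over_inj D) (@under_inj D) (@over_neq_under D).

(* The dart d is one of the two ends of an edge joining x and y. *)
Definition joins (d : dart) (x y : node D) : bool :=
  ((d.1, (opposite d).1) == (x, y)) || ((d.1, (opposite d).1) == (y, x)).

(* a, b, c are the corners of a triangular face bounded by a segment of a top
   strand from a to b, a segment of a middle strand from a to c, and a segment
   of a bottom strand from b to c, up to directions. *)
Definition triangle (a b c : crossing D) : Prop :=
  uniq [:: a; b; c] /\
  exists d1 d2 d3 : dart,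
    [/\ joins d1 (over a) (over b),
        joins d2 (under a) (over c),
        joins d3 (under b) (under c)
      & fcycle face [:: d1; d2; d3] || fcycle face [:: d3; d2; d1]].

End Diagrams.

(* D' is, up to isomorphism, the diagram obtained from D by erasing the nodes
   in S and the crossings through them, the strands being joined across the
   erased nodes. Every strand must keep at least one node. For S = set0 this
   says that D and D' are isomorphic. *)
Definition erasure (D D' : diagram) (S : {set node D}) : Prop :=
  exists (f : node D' -> node D) (g : crossing D' -> crossing D),
    [/\ injective f /\ injective g,
        forall x, (x \in codom f) = (x \notin S),
        forall c, (c \in codom g) = (over c \notin S) /\
                  (c \in codom g) = (under c \notin S),
        forall c, [/\ over (g c) = f (over c), under (g c) = f (under c)
                    & positive (g c) = positive c]
      & (forall x, exists n, iter n (next D) x \notin S) /\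
        (forall x, exists n, iter n.+1 (next D) (f x) = f (next D' x) /\
           forall i, (0 < i <= n)%N -> iter i (next D) (f x) \in S)].

Inductive subdivision_move : diagram -> diagram -> Prop :=
| Subdivision D D' (S : {set node D}) :
    (forall x, x \in S -> bivalent x) -> erasure D' S -> subdivision_move D D'.

Inductive R1_move : diagram -> diagram -> Prop :=
| R1 D D' (c : crossing D) :
    next D (over c) = under c \/ next D (under c) = over c ->
    erasure D' [set over c; under c] -> R1_move D D'.

(* The sign condition makes the two edges joining c and c' bound a bigon. *)
Inductive R2_move : diagram -> diagram -> Prop :=
| R2 D D' (c c' : crossing D) :
    positive c != positive c' ->
    next D (over c) = over c' ->
    next D (under c) = under c' \/ next D (under c') = under c ->
    erasure D' [set over c; over c'; under c; under c'] -> R2_move D D'.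

(* Each of the three strands meets the other two in the opposite order. *)
Inductive R3_move : diagram -> diagram -> Prop :=
| R3 D (a b c : crossing D) :
    triangle a b c ->
    R3_move D (with_next (next D ^
      (tperm (over a) (over b) * tperm (under a) (over c) *
       tperm (under b) (under c)))%g).

Definition planar_equiv (move : diagram -> diagram -> Prop) :=
  clos_refl_sym_trans diagram
    (fun D D' => [/\ planar D, planar D' & move D D']).

Definition R2_equiv : diagram -> diagram -> Prop :=
  planar_equiv (fun D D' => subdivision_move D D' \/ R2_move D D').

(* By Reidemeister's theorem, for planar diagrams this is equality of the
   oriented links they represent. *)
Definition link_equiv : diagram -> diagram -> Prop :=
  planar_equiv (fun D D' => [\/ subdivision_move D D', R1_move D D',
                                R2_move D D' | R3_move D D']).

(* The node (t, j) is the strand in column j entering level t; the crossing of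
   the t-th letter is at level t, and the last level carries no crossing. *)

Section Closure.
Variables (m : nat) (w : braid_word m).

Let level := 'I_(size w).+1.
Let letter (t : 'I_(size w)) : 'I_m * bool := tnth (in_tuple w) t.
Let lcol t := left_strand (letter t).1.
Let rcol t := right_strand (letter t).1.

Definition closure_over (t : 'I_(size w)) : level * 'I_m.+1 :=
  (lift ord_max t, if (letter t).2 then rcol t else lcol t).

Definition closure_under (t : 'I_(size w)) : level * 'I_m.+1 :=
  (lift ord_max t, if (letter t).2 then lcol t else rcol t).

Definition level_perm (t : level) : {perm 'I_m.+1} :=
  if unlift ord_max t is Some s then tperm (lcol s) (rcol s) else 1%g.

Definition closure_step (x : level * 'I_m.+1) : level * 'I_m.+1 :=
  (ordS x.1, level_perm x.1 x.2).

Fact closure_step_inj : injective closure_step.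
Proof.
move=> [t i] [t' i'] /= /eqP/[!xpair_eqE]/andP[/eqP/ordS_inj/= <- /eqP].
by move=> /perm_inj <-.
Qed.

Fact closure_over_inj : injective closure_over.
Proof. by move=> t t' /(congr1 fst) /lift_inj. Qed.

Fact closure_under_inj : injective closure_under.
Proof. by move=> t t' /(congr1 fst) /lift_inj. Qed.

Fact closure_over_neq_under t t' : closure_over t != closure_under t'.
Proof.
have lr s : lcol s != rcol s by rewrite -val_eqE /= /bump add1n ltn_eqF.
apply/eqP=> e; move: (congr1 fst e) (congr1 snd e) => /lift_inj <- /= /eqP.
by case: (letter t).2; rewrite ?(negPf (lr t)) // eq_sym (negPf (lr t)).
Qed.

Definition braid_closure : diagram :=
  Diagram (fun t => (letter t).2) (perm closure_step_inj)
    closure_over_inj closure_under_inj closure_over_neq_under.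

End Closure.

(* Main.v *)
Require Import Defs.
From HB Require Import structures.
From mathcomp Require Import all_boot all_order all_algebra all_fingroup.
From mathcomp Require Import qpoly.
Import Defs.

Set Implicit Arguments.
Unset Strict Implicit.
Unset Printing Implicit Defensive.

Import GRing.Theory.
Local Open Scope ring_scope.

(** In the basis of states, that is of colourings of the m.+1 strand positions
    at a fixed height by Q, each generator of the braid group acts by a
    monomial matrix: it permutes the states and multiplies by 1 + hbar * (sign)
    * psi, with psi taken at the colours of the crossing [entry_generator].
    Since hbar squares to zero, these factors multiply by adding their slopes,
    so Psi_op b sends a state x to the state below the braid, multiplied by
    1 + hbar * (sum of the signed values of psi) [entry_Psi_op]. Only the states
    carried to themselves contribute to the trace, and they are the colourings
    of the closed braid. This gives the formula for the closure of b
    [Phi_fixed_states, state_sum_closure].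

    To transport it to another diagram, the sum of 1 + hbar * weight over all
    colourings is attached to each diagram [state_sum]. It is computed with
    colours on edges rather than on arcs: an edge colouring is a function on
    nodes subject to one equation per node, hence easy to restrict and extend
    when nodes are erased, whereas a change of diagram changes the type of
    arcs. Both descriptions agree by [state_sum_diagram].

    For a second Reidemeister move, the two crossings have opposite signs and
    the same over-colour, so that the under-strand recovers its colour after
    both and their weights are opposite. The move is split in two: first the
    two crossings are cancelled while all nodes stay in place
    [state_sum_cancel], which is a local change of one colour; then the nodes
    left without a crossing are erased [state_sum_subdivision].

    The remaining case assumes the trace condition of an enhanced Yang-Baxter
    operator with trivial scalars. The diagonal entry at q of the partial trace
    of the deformed operator is 1 + hbar * psi q q, where the group element
    psi q q is a nonzero element of Z[A]; so the condition forces Q to be empty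
    [not_enhanced_Yang_Baxter]. Then no diagram with a node has a colouring, and
    link equivalence preserves the existence of a node. *)

(** * Dual numbers *)

Section DualNumbers.
Variable k : comNzRingType.
Local Notation C := (qpolyC ('X^2 : {poly k})).

Lemma hbar_sqr : hbar k * hbar k = 0.
Proof.
apply/val_inj/(etrans (poly_of_qpolyM _ _)).
have -> : hbar k = 'X :> {poly k} by rewrite qpolyXE ?size_polyXn ?monicXn.
transitivity (0 : {poly k}) => //.
by rewrite mk_monic_Xn -expr2 Pdiv.RingMonic.rmodpp ?monicXn.
Qed.

Lemma poly_of_dual (a b : k) :
  C a + hbar k * C b = a%:P + b *: 'X :> {poly k}.
Proof.
rewrite poly_of_qpolyD poly_of_qpolyM !qpolyCE.
have -> : hbar k = 'X :> {poly k} by rewrite qpolyXE ?size_polyXn ?monicXn.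
rewrite mk_monic_Xn Pdiv.CommonRing.rmodp_small ?size_polyXn; last first.
  by rewrite mulrC mul_polyC (leq_ltn_trans (size_scale_leq _ _)) ?size_polyX.
by rewrite mulrC mul_polyC.
Qed.

Lemma coef0_dual (a b : k) : (C a + hbar k * C b : {poly k})`_0 = a.
Proof. by rewrite poly_of_dual coefD coefC coefZ coefX mulr0 addr0. Qed.

Lemma coef1_dual (a b : k) : (C a + hbar k * C b : {poly k})`_1 = b.
Proof. by rewrite poly_of_dual coefD coefC coefZ coefX mulr1 add0r. Qed.

Definition unit_deformation (a : k) : dual k := 1 + hbar k * C a.

Lemma unit_deformation0 : unit_deformation 0 = 1.
Proof. by rewrite /unit_deformation qpolyC0 mulr0 addr0. Qed.

(** The quadratic term vanishes, so slopes behave like logarithms: products of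
    local factors become sums of local weights. *)
Lemma unit_deformationD a b :
  unit_deformation (a + b) = unit_deformation a * unit_deformation b.
Proof.
rewrite /unit_deformation mulrDl mul1r mulrDr mulr1 mulrACA hbar_sqr mul0r.
by rewrite addr0 qpolyCD mulrDr addrA addrAC.
Qed.

Lemma sum_unit_deformation (I : finType) (P : pred I) (F : I -> k) :
  \sum_(i | P i) unit_deformation (F i) =
  #|P|%:R + hbar k * C (\sum_(i | P i) F i).
Proof.
rewrite big_split /= -sumr_const -mulr_sumr; congr (_ + hbar k * _).
by rewrite rmorph_sum.
Qed.

End DualNumbers.

(** * Colours carried across a crossing *)

Section Turn.
Variable Q : quandle.

(** The colour of the strand leaving a crossing from below, given its incoming
    colour x and the colour y of the over-strand; at a negative crossing the
    equation to solve is qop (turn false y x) y = x. *)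
Definition turn (pos : bool) (y x : Q) : Q :=
  if pos then qop x y else invF (bij_inj (qop_bij y)) x.

Lemma turnK pos y : cancel (turn pos y) (turn (~~ pos) y).
Proof.
by case: pos => x; rewrite /turn /= ?(invF_f (bij_inj (qop_bij y)))
  ?(f_invF (bij_inj (qop_bij y))).
Qed.

Lemma eq_turn_false y x z : (z == turn false y x) = (x == qop z y).
Proof.
apply/eqP/eqP=> [->|->]; first by rewrite -[LHS](turnK false y).
by rewrite -[LHS](turnK true y).
Qed.

End Turn.

Arguments turn : simpl never.

(** * Edge colourings *)

Section EdgeColorings.
Variables (Q : quandle) (A : finZmodType) (psi : Q -> Q -> A).
Local Notation k := (group_ring A).

(** Here x is the incoming under-colour; the under-arc to the right of the
    over-strand is the incoming one only at a positive crossing. *)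
Definition crossing_weight (pos : bool) (x y : Q) : k :=
  (if pos then 1 else -1) * gr_elt (psi (if pos then x else turn false y x) y).

Section OneDiagram.
Variable D : diagram.
Implicit Types (l : {ffun node D -> Q}) (c : crossing D) (x : node D).

(** The value l x is the colour of the edge arriving at the node x. With this
    choice the colour of an over-strand is read off at the crossing itself, and
    each equation determines the colour of the next edge. *)
Definition edge_coloring (l : {ffun node D -> Q}) : bool :=
  [forall c, l (next D (under c)) ==
             turn (positive c) (l (over c)) (l (under c))] &&
  [forall x, (x \notin codom (@under D)) ==> (l (next D x) == l x)].

Lemma edge_coloringP l :
  reflect ((forall c, l (next D (under c)) =
                      turn (positive c) (l (over c)) (l (under c))) /\
           (forall x, x \notin codom (@under D) -> l (next D x) = l x))
          (edge_coloring l).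
Proof.
apply: (iffP andP) => -[cl el]; split.
- by move=> c; apply/eqP/(forallP cl).
- by move=> x ux; apply/eqP/(implyP (forallP el x)).
- by apply/forallP=> c; rewrite cl.
- by apply/forallP=> x; apply/implyP=> /el ->.
Qed.

Definition weight l : k :=
  \sum_c crossing_weight (positive c) (l (under c)) (l (over c)).

Definition state_sum : dual k :=
  \sum_(l | edge_coloring l) unit_deformation (weight l).

Lemma over_notin_under c : over c \notin codom (@under D).
Proof. by apply/negP=> /codomP[c' /eqP]; apply/negP/over_neq_under. Qed.

Lemma edge_coloring_over l c :
  edge_coloring l -> l (next D (over c)) = l (over c).
Proof. by case/edge_coloringP=> _; apply; apply: over_notin_under. Qed.

End OneDiagram.

(** All comparisons of diagrams below are weight-preserving bijections between
    their colourings. *)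
Lemma eq_state_sum (D D' : diagram)
    (h : {ffun node D -> Q} -> {ffun node D' -> Q})
    (h' : {ffun node D' -> Q} -> {ffun node D -> Q}) :
    (forall l, edge_coloring l ->
       [/\ edge_coloring (h l), h' (h l) = l & weight (h l) = weight l]) ->
    (forall l, edge_coloring l -> edge_coloring (h' l) /\ h (h' l) = l) ->
  state_sum D = state_sum D'.
Proof.
move=> hP h'P; rewrite /state_sum [RHS](reindex_onto h h') => [|l /h'P[]//].
rewrite [RHS](eq_bigl (@edge_coloring D)) => [|l].
  by apply: eq_bigr => l /hP[_ _ ->].
apply/idP/idP=> [/andP[/h'P[hl _] /eqP <-] // | /hP[-> -> _]]; exact: eqxx.
Qed.

End EdgeColorings.

(** * Colourings of arcs *)

Section ArcColorings.
Variables (Q : quandle) (A : finZmodType) (psi : Q -> Q -> A) (D : diagram).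
Local Notation k := (group_ring A).

Implicit Types (l : {ffun node D -> Q}) (C : {ffun arc_type D -> Q}).

Lemma same_arc_equiv : equivalence_rel (@same_arc D).
Proof.
have sym : connect_sym [rel x y : node D |
    (y == next D x) && (y \notin codom (@under D)) ||
    (x == next D y) && (x \notin codom (@under D))].
  by apply: sym_connect_sym => x y /=; rewrite orbC.
move=> x y z; split; first exact: connect0.
by move=> xy; apply: (same_connect sym).
Qed.

Lemma arc_of_eq x y : same_arc x y -> arc_of x = arc_of y :> arc_type D.
Proof.
move=> xy; apply: val_inj; apply/setP=> z; rewrite /= !inE.
by have [_ ->] := same_arc_equiv x y z.
Qed.

Lemma arc_of_next x : next D x \notin codom (@under D) ->
  arc_of (next D x) = arc_of x.
Proof. by move=> ux; apply/esym/arc_of_eq/connect1; rewrite /= eqxx ux. Qed.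

(** The edge arriving at a node is the one that leaves the previous node. *)
Definition edge_colors (C : {ffun arc_type D -> Q}) : {ffun node D -> Q} :=
  [ffun x => C (arc_of ((next D)^-1%g x))].

Lemma arc_type_rep (a : arc_type D) : {x | a = arc_of x}.
Proof.
have /imsetP/sig2_eqW [x _ ax] := valP a.
by exists x; apply: val_inj.
Qed.

Definition arc_colors (l : {ffun node D -> Q}) : {ffun arc_type D -> Q} :=
  [ffun a => l (next D (sval (arc_type_rep a)))].

Lemma edge_colorsE C x : edge_colors C (next D x) = C (arc_of x).
Proof. by rewrite ffunE permK. Qed.

Lemma edge_colors_over C c : edge_colors C (over c) = C (over_arc c).
Proof.
rewrite ffunE /over_arc -{2}[over c](permKV (next D)) arc_of_next //.
by rewrite permKV over_notin_under.
Qed.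

Lemma edge_coloring_arc l x y : edge_coloring l -> same_arc x y ->
  l (next D x) = l (next D y).
Proof.
move=> /edge_coloringP[_ el] /connectP[p + ->].
elim: p x => //= z p IHp x /andP[xz /IHp <-].
by case/orP: xz => /andP[/eqP -> /el].
Qed.

Lemma arc_colorsE l x :
  edge_coloring l -> arc_colors l (arc_of x) = l (next D x).
Proof.
move=> cl; rewrite ffunE; case: arc_type_rep => y /= /(congr1 val)/= xy.
apply/esym/edge_coloring_arc => //.
have : y \in arc_set y by rewrite inE; have [] := same_arc_equiv y y y.
by rewrite -xy inE.
Qed.

Lemma colorings_edge C : (C \in colorings D Q) = edge_coloring (edge_colors C).
Proof.
rewrite inE /edge_coloring; rewrite [X in _ && X](_ : _ = true) ?andbT.
  apply: eq_forallb => c; rewrite edge_colorsE edge_colors_over.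
  rewrite /left_arc /right_arc /under_in /under_out ffunE.
  by case: (positive c) => //; rewrite eq_turn_false.
apply/forallP=> x; apply/implyP=> ux; rewrite edge_colorsE ffunE.
by rewrite -{1}[x](permKV (next D)) arc_of_next ?permKV.
Qed.

Lemma crossing_weight_edge C c : C \in colorings D Q ->
  crossing_weight psi (positive c) (edge_colors C (under c))
    (edge_colors C (over c)) =
  (if positive c then 1 else -1) *
    gr_elt (psi (C (right_arc c)) (C (over_arc c))).
Proof.
rewrite /crossing_weight colorings_edge => /edge_coloringP[/(_ c)].
rewrite edge_colorsE edge_colors_over /right_arc /under_in /under_out ffunE.
by case: (positive c) => // ->.
Qed.

(** Arc colourings and edge colourings correspond, with equal weights; the
    constant term of the state sum then counts them. *)
Lemma state_sum_diagram :
  state_sum psi D =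
  #|colorings D Q|%:R + hbar k * qpolyC 'X^2 (cocycle_sum D psi).
Proof.
rewrite /cocycle_sum -sum_unit_deformation /state_sum.
rewrite (reindex_onto edge_colors arc_colors) => [|l cl].
  apply: eq_big => [C|C /andP[cC _]].
    rewrite -[RHS]/(C \in colorings D Q) colorings_edge andb_idr // => cC.
    by apply/eqP/ffunP=> a; have [x ->] := arc_type_rep a;
      rewrite arc_colorsE ?edge_colorsE.
  congr unit_deformation; apply: eq_bigr => c _.
  by rewrite crossing_weight_edge ?colorings_edge.
by apply/ffunP=> x; rewrite ffunE arc_colorsE ?permKV.
Qed.

End ArcColorings.

(** * Erasing nodes *)

(** The retraction r follows the orbit of y to the first point outside S. An edge
    arriving at an erased node is thus merged into the edge arriving at that
    first surviving node, which is why edges are indexed by their heads. *)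
Lemma first_return_retraction (T T' : finType) (p : {perm T}) (p' : {perm T'})
    (S : {set T}) (f : T' -> T) :
  injective f -> (forall y, (y \in codom f) = (y \notin S)) ->
  (forall y, exists n, iter n p y \notin S) ->
  (forall x, exists n, iter n.+1 p (f x) = f (p' x) /\
     forall i, (0 < i <= n)%N -> iter i p (f x) \in S) ->
  exists r : T -> T',
    [/\ cancel f r,
        forall y, y \in S -> r (p y) = r y,
        forall x, r (p (f x)) = p' x
      & forall (X : Type) (l : T -> X),
          (forall y, y \in S -> l (p y) = l y) -> forall y, l (f (r y)) = l y].
Proof.
move=> f_inj fS exit return_.
pose n y := ex_minn (exit y); pose e y := iter (n y) p y.
have eS y : e y \notin S by rewrite /e /n; case: ex_minnP.
have eP y : e y \in codom f by rewrite fS.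
pose r y := iinv (eP y).
have fr y : f (r y) = e y by rewrite /r f_iinv.
have e_id y : y \notin S -> e y = y.
  rewrite /e /n; case: ex_minnP => k _ kmin yS.
  by have := kmin 0 yS; rewrite leqn0 => /eqP ->.
have e_next y : y \in S -> e (p y) = e y.
  rewrite /e /n => yS; case: (ex_minnP (exit y)) => -[|k].
    by rewrite /= yS.
  rewrite iterSr => kS kmin; rewrite -iterSr iterSr; congr (iter _ p _).
  case: ex_minnP => j jS jmin; apply/eqP; rewrite eqn_leq jmin //=.
  by have := kmin j.+1; rewrite iterSr => /(_ jS).
exists r; split=> [x|y yS|x|X l lS y].
- by apply: f_inj; rewrite fr e_id // -fS codom_f.
- by apply: f_inj; rewrite !fr e_next.
- have [j [jx jS]] := return_ x; apply: f_inj; rewrite fr -jx.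
  (* All points strictly between f x and f (p' x) are skipped by e. *)
  have : e (iter j.+1 p (f x)) = e (p (f x)).
    elim: j {jx} jS => // j IHj jS; rewrite -IHj => [|i /andP[i0 ij]].
      by rewrite iterS e_next // jS //= leqnn.
    by apply: jS; rewrite i0 leqW.
  by move=> <-; rewrite e_id // jx -fS codom_f.
rewrite fr /e /n; case: ex_minnP => k _ kmin.
have : forall i, (i <= k)%N -> l (iter i p y) = l y.
  elim=> // i IHi ik; rewrite iterS lS ?IHi 1?ltnW //.
  by apply: contraLR ik => iS; rewrite -leqNgt kmin.
exact.
Qed.

Section Moves.
Variables (Q : quandle) (A : finZmodType) (psi : Q -> Q -> A).

(** No colour changes at a bivalent node, so colourings restrict along f and
    extend along the retraction r; no crossing is lost. *)
Lemma state_sum_subdivision (D D' : diagram) (S : {set node D}) :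
  (forall x, x \in S -> bivalent x) -> erasure D' S ->
  state_sum psi D = state_sum psi D'.
Proof.
move=> Sbi [f [g [[f_inj g_inj] fS gS fg [exit return_]]]].
have [r [fK rS rf lr]] := first_return_retraction f_inj fS exit return_.
have S_under x : x \in S -> x \notin codom (@under D).
  by move=> /Sbi/andP[].
have g_onto u : u \in codom g.
  by have [_ ->] := gS u; apply/negP=> /S_under; rewrite codom_f.
have under_f x : (f x \in codom (@under D)) = (x \in codom (@under D')).
  apply/codomP/codomP=> -[u xu].
    have /codomP[u' def_u] := g_onto u; exists u'; apply: f_inj.
    by rewrite xu def_u; have [] := fg u'.
  by exists (g u); rewrite xu; have [] := fg u.
have const_S l y : @edge_coloring Q D l -> y \in S -> l (next D y) = l y.
  by case/edge_coloringP=> _ cl /S_under /cl.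
pose h (l : {ffun node D -> Q}) : {ffun node D' -> Q} := [ffun x => l (f x)].
pose h' (l : {ffun node D' -> Q}) : {ffun node D -> Q} := [ffun y => l (r y)].
apply: (eq_state_sum (h := h) (h' := h')) => l cl.
  have lrl y : l (f (r y)) = l y by apply: lr => z /const_S ->.
  have [cu co] := edge_coloringP _ cl; split.
  - apply/edge_coloringP; split=> [c|x]; rewrite !ffunE.
      have [<- <- <-] := fg c.
      by rewrite -cu -rf lrl; have [_ <- _] := fg c.
    by rewrite -under_f => /co <-; rewrite -rf lrl.
  - by apply/ffunP=> y; rewrite !ffunE lrl.
  rewrite /weight [RHS](reindex g) /=; last first.
    exists (fun u => iinv (g_onto u)) => u _; last exact: f_iinv.
    by apply: g_inj; rewrite f_iinv.
  by apply: eq_bigr => c _; have [-> -> ->] := fg c; rewrite !ffunE.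
have [cu co] := edge_coloringP _ cl; split; last first.
  by apply/ffunP=> x; rewrite !ffunE fK.
apply/edge_coloringP; split=> [u|y uy]; rewrite !ffunE.
  have /codomP[c ->] := g_onto u.
  by have [-> -> ->] := fg c; rewrite rf cu !fK.
have [yS|] := boolP (y \in S); first by rewrite rS.
rewrite -fS => /codomP[x def_y]; move: uy.
by rewrite def_y under_f rf fK => /co.
Qed.

Section CancelCrossings.
Variables (D : diagram) (c1 c2 : crossing D).

Definition other_crossing := {c : crossing D | (c != c1) && (c != c2)}.

(** The two strands keep their nodes and pass through each other, so this is a
    diagram of a virtual link only, which may well fail to be planar. *)
Definition cancel_crossings : diagram :=
  @Diagram (node D) other_crossing (fun c => over (val c))
    (fun c => under (val c)) (fun c => positive (val c)) (next D)
    (inj_comp (@over_inj D) val_inj) (inj_comp (@under_inj D) val_inj)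
    (fun c c' => over_neq_under (val c) (val c')).

Hypothesis opp_signs : positive c1 != positive c2.
Hypothesis same_over :
  next D (over c1) = over c2 \/ next D (over c2) = over c1.
Hypothesis next_under : next D (under c1) = under c2.

Let c21 : c2 != c1.
Proof. by apply: contraNneq opp_signs => ->. Qed.

Let under21 : under c2 != under c1.
Proof. by rewrite (inj_eq (@under_inj D)). Qed.

Let sign2 : positive c2 = ~~ positive c1.
Proof. by move: opp_signs; case: (positive c1); case: (positive c2). Qed.

(** The two systems of equations differ only in the colour of the edge joining
    the two under-passages: once the crossings are cancelled it carries the
    colour of the edge before them. *)
Definition merge_colors (l : {ffun node D -> Q}) : {ffun node D -> Q} :=
  [ffun x => l (if x == under c2 then under c1 else x)].

Definition split_colors (l : {ffun node D -> Q}) : {ffun node D -> Q} :=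
  [ffun x => if x == under c2
     then turn (positive c1) (l (over c1)) (l (under c1)) else l x].

Lemma merge_colorsN l x : x != under c2 -> merge_colors l x = l x.
Proof. by rewrite ffunE => /negPf->. Qed.

Lemma split_colorsN l x : x != under c2 -> split_colors l x = l x.
Proof. by rewrite ffunE => /negPf->. Qed.

Lemma next_neq_under2 x : x != under c1 -> next D x != under c2.
Proof. by rewrite -next_under (inj_eq perm_inj). Qed.

Lemma under_cancel x : (x \in codom (@under cancel_crossings)) =
  [&& x \in codom (@under D), x != under c1 & x != under c2].
Proof.
apply/codomP/and3P=> [[[c /= cP]] ->|[/codomP[c ->]]].
  by rewrite codom_f !(inj_eq (@under_inj D)); case/andP: cP.
rewrite !(inj_eq (@under_inj D)) => n1 n2.
by exists (exist _ c (introT andP (conj n1 n2))).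
Qed.

(** The under-edges to the right of the over-strand are the edge between the two
    crossings for both of them, or else the two outer edges; in either case
    they have the same colour, so the same value of psi occurs with opposite
    signs. *)
Lemma weight_cancel (l : {ffun node D -> Q}) : edge_coloring l ->
  weight psi (D := cancel_crossings) (merge_colors l) = weight psi l.
Proof.
move=> cl; have [cu co] := edge_coloringP _ cl.
have over12 : l (over c2) = l (over c1).
  by case: same_over => <-; rewrite edge_coloring_over.
rewrite /weight [RHS](bigD1 c1) //= [X in _ = _ + X](bigD1 c2) //= addrA.
rewrite [X in _ = X + _](_ : _ = 0) ?add0r.
  rewrite [RHS](reindex_omap (J := other_crossing) val insub) => [|c cP];
    last by rewrite insubT.
  rewrite [RHS](eq_bigl xpredT) => [|c]; last by rewrite valK eqxx (valP c).
  apply: eq_bigr => -[c /= /andP[n1 n2]] _; congr crossing_weight.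
    by rewrite merge_colorsN // (inj_eq (@under_inj D)).
  by rewrite merge_colorsN // over_neq_under.
have -> : l (under c2) = turn (positive c1) (l (over c1)) (l (under c1)).
  by rewrite -next_under cu.
rewrite /crossing_weight sign2 over12; case: (positive c1) => /=.
  by rewrite [turn false _ _](turnK true) mulN1r mul1r subrr.
by rewrite mulN1r mul1r addNr.
Qed.

(** Turning by opposite signs under the same colour is the identity, so the edge
    leaving the second under-passage has the colour of the edge arriving at the
    first. *)
Lemma state_sum_cancel : state_sum psi D = state_sum psi cancel_crossings.
Proof.
apply: (eq_state_sum (D := D) (D' := cancel_crossings)
  (h := merge_colors) (h' := split_colors)) => l cl.
  have [cu co] := edge_coloringP _ cl.
  have over12 : l (over c2) = l (over c1).
    by case: same_over => <-; rewrite edge_coloring_over.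
  split; last exact: weight_cancel.
    apply/edge_coloringP; split=> [[c /= /andP[n1 n2]]|x].
      have u1 : under c != under c1 by rewrite (inj_eq (@under_inj D)).
      have u2 : under c != under c2 by rewrite (inj_eq (@under_inj D)).
      by rewrite !merge_colorsN ?next_neq_under2 ?over_neq_under.
    rewrite under_cancel => xu.
    have [->|x1] := eqVneq x (under c1).
      by rewrite next_under !ffunE eqxx eq_sym (negPf under21).
    rewrite merge_colorsN ?next_neq_under2 //.
    have [->|x2] := eqVneq x (under c2).
      by rewrite ffunE eqxx cu sign2 over12 -next_under cu turnK.
    by rewrite merge_colorsN // co //; move: xu; rewrite x1 x2 !andbT.
  apply/ffunP=> x; rewrite ffunE; case: eqP => [->|/eqP x2].
    by rewrite !merge_colorsN ?over_neq_under 1?eq_sym // -cu next_under.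
  by rewrite merge_colorsN.
have [cu co] := edge_coloringP _ cl.
have over12 : l (over c2) = l (over c1).
  by case: same_over => <-; rewrite co // under_cancel negb_and over_notin_under.
have merge12 : l (under c2) = l (under c1).
  by rewrite -next_under co // under_cancel eqxx andbF.
split; last first.
  apply/ffunP=> x; rewrite ffunE; case: eqP => [->|/eqP x2].
    by rewrite split_colorsN 1?eq_sym.
  by rewrite split_colorsN.
apply/edge_coloringP; split=> [c|x xu].
  have [->|n1] := eqVneq c c1.
    rewrite next_under ffunE eqxx.
    by rewrite !split_colorsN ?over_neq_under 1?eq_sym.
  have u1 : under c != under c1 by rewrite (inj_eq (@under_inj D)).
  rewrite split_colorsN ?next_neq_under2 //.
  rewrite [split_colors l (over c)]split_colorsN ?over_neq_under //.
  have [->|n2] := eqVneq c c2.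
    rewrite ffunE eqxx over12 sign2 turnK -merge12 co //.
    by rewrite under_cancel eqxx !andbF.
  rewrite split_colorsN ?(inj_eq (@under_inj D)) //.
  exact: (cu (exist _ c (introT andP (conj n1 n2)))).
have x1 : x != under c1 by apply: contraNneq xu => ->; rewrite codom_f.
have x2 : x != under c2 by apply: contraNneq xu => ->; rewrite codom_f.
by rewrite !split_colorsN ?next_neq_under2 // co // under_cancel (negPf xu).
Qed.

Lemma cancel_bivalent x : x \in [set over c1; over c2; under c1; under c2] ->
  bivalent (D := cancel_crossings) x.
Proof.
move=> xS; rewrite /bivalent under_cancel; apply/andP; split.
  apply/negP=> /codomP[[c /= /andP[n1 n2]] def_x]; move: xS.
  rewrite def_x !inE !(inj_eq (@over_inj D)) (negPf n1) (negPf n2).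
  by rewrite !(negPf (over_neq_under _ _)).
move: xS; rewrite !inE -!orbA => /or4P[] /eqP->; rewrite ?eqxx ?andbF //.
  by rewrite negb_and over_notin_under.
by rewrite negb_and over_notin_under.
Qed.

(** The crossings that survive the erasure are among those kept by the
    cancellation, so the same node map still exhibits D' as an erasure. *)
Lemma erasure_cancel (D' : diagram) (S : {set node D}) :
  S = [set over c1; over c2; under c1; under c2] -> erasure D' S ->
  erasure (D := cancel_crossings) D' S.
Proof.
move=> defS [f [g [[f_inj g_inj] fS gS fg ret]]].
have gP c : (g c != c1) && (g c != c2).
  have [gc _] := gS (g c); move: gc; rewrite codom_f => /esym.
  rewrite defS !inE !(inj_eq (@over_inj D)) !negb_or.
  by case/andP=> /andP[/andP[-> ->] _] _.
exists f, (fun c => exist _ (g c) (gP c)).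
have g'S (c : other_crossing) :
    (c \in codom (fun c => exist _ (g c) (gP c) : other_crossing)) =
    (val c \in codom g).
  apply/codomP/codomP=> -[c' def_c]; exists c'; first by rewrite def_c.
  exact: val_inj.
split=> //; first by split=> // c c' /(congr1 val)/g_inj.
by move=> c; rewrite !g'S; apply: gS.
Qed.

End CancelCrossings.

(** The two under-passages may be met in either order; the roles of c and c'
    are chosen so that the under-strand meets c1 first. *)
Lemma state_sum_R2 (D D' : diagram) : R2_move D D' ->
  state_sum psi D = state_sum psi D'.
Proof.
case=> {}D {}D' c c' sgn next_over next_under er.
have R2_oriented (c1 c2 : crossing D) : positive c1 != positive c2 ->
    next D (over c1) = over c2 \/ next D (over c2) = over c1 ->
    next D (under c1) = under c2 ->
    [set over c; over c'; under c; under c'] =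
      [set over c1; over c2; under c1; under c2] ->
    state_sum psi D = state_sum psi D'.
  move=> sgn12 o12 u12 eqS; rewrite (state_sum_cancel sgn12 o12 u12).
  apply: (@state_sum_subdivision (cancel_crossings c1 c2) D'
      [set over c; over c'; under c; under c']);
    last exact: erasure_cancel er.
  by move=> x xS; apply: cancel_bivalent; rewrite -eqS.
case: next_under => next_u; first by apply: (R2_oriented c c') => //; left.
apply: (R2_oriented c' c) => //; [by rewrite eq_sym | by right |].
by apply/setP=> x; rewrite !inE -!orbA; do !bool_congr.
Qed.

Lemma state_sum_R2_equiv (D D' : diagram) : R2_equiv D D' ->
  state_sum psi D = state_sum psi D'.
Proof.
elim=> {D D'} [D D' [_ _ [[{}D {}D' S Sbi er]|/state_sum_R2 //]]| |D D' _ -> //|].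
- exact: state_sum_subdivision Sbi er.
- by [].
- by move=> D1 D2 D3 _ -> _ ->.
Qed.

End Moves.

(** * Monomial operators *)

Section Entries.
Variables (K : comNzRingType) (B : finType).
Implicit Types M N : 'M[K]_#|B|.

Lemma entry_op_of (F : B -> B -> K) x y : entry (op_of F) x y = F x y.
Proof. by rewrite /entry mxE !enum_rankK. Qed.

Lemma entry1 x y : entry (1%:M : 'M[K]_#|B|) x y = (y == x)%:R.
Proof. by rewrite /entry mxE (inj_eq enum_rank_inj) eq_sym. Qed.

Lemma eq_entry M N : (forall x y, entry M x y = entry N x y) -> M = N.
Proof.
move=> eqMN; apply/matrixP=> i j.
by have := eqMN (enum_val i) (enum_val j); rewrite /entry !enum_valK.
Qed.

Lemma entry_mul M N x z :
  entry (M *m N) x z = \sum_y entry M x y * entry N y z.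
Proof.
rewrite /entry mxE (reindex (@enum_rank B)) //=.
by apply: onW_bij; apply: enum_rank_bij.
Qed.

Lemma trace_entry M : \tr M = \sum_x entry M x x.
Proof.
rewrite /mxtrace (reindex (@enum_rank B)) //=.
by apply: onW_bij; apply: enum_rank_bij.
Qed.

Lemma entry_mul_monomial_row M N (c : K) x x' z :
  (forall y, entry M x y = c * (y == x')%:R) ->
  entry (M *m N) x z = c * entry N x' z.
Proof.
move=> defM; rewrite entry_mul (bigD1 x') //= defM eqxx mulr1.
by rewrite big1 ?addr0 // => y /negPf yx'; rewrite defM yx' mulr0 mul0r.
Qed.

End Entries.

(** * The braid operator *)

Section BraidOperator.
Variables (Q : quandle) (A : finZmodType) (psi : Q -> Q -> A).
Local Notation k := (group_ring A).

Lemma entry_Rtilde (p q : Q * Q) :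
  entry (Rtilde psi) p q =
  unit_deformation (crossing_weight psi true p.1 p.2) *
  (q == (p.2, turn true p.2 p.1))%:R.
Proof.
rewrite /entry !mxE -/(entry _ _ _) entry_op_of !enum_rankK.
rewrite /unit_deformation /crossing_weight mul1r qpolyCM !rmorph_nat.
by rewrite mulrA mulrDl mul1r.
Qed.

(** The matrix with the inverse permutation and the opposite slopes is a left
    inverse, and a left inverse equals the inverse that was chosen. *)
Lemma entry_Rtilde_inv (p q : Q * Q) :
  entry (Rtilde_inv psi) p q =
  unit_deformation (crossing_weight psi false p.2 p.1) *
  (q == (turn false p.1 p.2, p.1))%:R.
Proof.
pose a (p : Q * Q) := unit_deformation (crossing_weight psi false p.2 p.1).
pose s (p : Q * Q) := (turn false p.1 p.2, p.1).
pose N := op_of (fun p q : Q * Q => a p * (q == s p)%:R).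
have defN p' q' : entry N p' q' = a p' * (q' == s p')%:R by rewrite entry_op_of.
have /andP[/eqP RR' _] := xchooseP (Rtilde_invertible psi).
suffices NR : N *m Rtilde psi = 1%:M.
  rewrite -/(a p) -/(s p) -defN; congr (entry _ p q).
  by rewrite /Rtilde_inv -[LHS]mul1mx -NR -mulmxA RR' mulmx1.
apply: eq_entry => -[x y] q'; rewrite (entry_mul_monomial_row _ _ (defN _)).
rewrite entry1 entry_Rtilde mulrA -unit_deformationD /crossing_weight /=.
rewrite mulN1r mul1r addNr unit_deformation0 mul1r.
by rewrite [turn true _ _](turnK false).
Qed.

Section Strands.
Variable m : nat.
Local Notation state := {ffun 'I_m.+1 -> Q}.
Implicit Types (a : 'I_m * bool) (x : state) (w : braid_word m).

Definition over_column a := if a.2 then right_strand a.1 else left_strand a.1.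
Definition under_column a := if a.2 then left_strand a.1 else right_strand a.1.

Lemma over_neq_under_column a : over_column a != under_column a.
Proof.
have lr : left_strand a.1 != right_strand a.1.
  by rewrite -val_eqE /= /bump add1n ltn_eqF.
by rewrite /over_column /under_column; case: a.2; rewrite // eq_sym.
Qed.

(** The permutation of states underlying R at a positive letter, and its inverse
    at a negative one. *)
Definition braid_step x a : state :=
  [ffun j => if j == over_column a
             then turn a.2 (x (over_column a)) (x (under_column a))
             else if j == under_column a then x (over_column a) else x j].

Definition braid_act w x : state := foldl braid_step x w.

Definition letter_weight x a : k :=
  crossing_weight psi a.2 (x (under_column a)) (x (over_column a)).

Definition word_weight w x : k :=
  \sum_(t < size w)
    letter_weight (braid_act (take t w) x) (tnth (in_tuple w) t).

Lemma word_weight_cons a w x :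
  word_weight (a :: w) x = letter_weight x a + word_weight w (braid_step x a).
Proof.
rewrite /word_weight big_ord_recl /=; congr (_ + _); apply: eq_bigr => t _.
by rewrite !(tnth_nth a).
Qed.

(** Both signs obey one rule once the columns are named by over and under. *)
Lemma entry_generator x y a :
  entry (op_at a.1 (if a.2 then Rtilde psi else Rtilde_inv psi)) x y =
  unit_deformation (letter_weight x a) * (y == braid_step x a)%:R.
Proof.
have stepE : (y == braid_step x a) =
    [&& y (left_strand a.1) == braid_step x a (left_strand a.1),
        y (right_strand a.1) == braid_step x a (right_strand a.1)
      & [forall j, [|| j == left_strand a.1, j == right_strand a.1
                    | x j == y j]]].
  apply/eqP/and3P=> [->|[/eqP yl /eqP yr /forallP yj]].
    rewrite !eqxx; split=> //; apply/forallP=> j; rewrite ffunE.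
    rewrite /over_column /under_column.
    by case: a.2; case: eqP => //= _; case: eqP => //= _; rewrite ?orbT.
  apply/ffunP=> j; have [->//|jl] := eqVneq j (left_strand a.1).
  have [->//|jr] := eqVneq j (right_strand a.1).
  have := yj j; rewrite (negPf jl) (negPf jr) /= => /eqP <-; rewrite ffunE.
  rewrite /over_column /under_column.
  by case: a.2; rewrite ?(negPf jl) ?(negPf jr).
rewrite /op_at entry_op_of stepE andbA -mulnb natrM mulrA; congr (_ * _).
have := over_neq_under_column a; have := over_neq_under_column a.
rewrite {1}eq_sym !ffunE /letter_weight /over_column /under_column.
case: a.2 => /negPf uo /negPf ou; rewrite !eqxx ?uo ?ou.
  by rewrite entry_Rtilde xpair_eqE.
by rewrite entry_Rtilde_inv xpair_eqE.
Qed.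

(** A product of monomial matrices is monomial: the permutations compose and the
    slopes, read along the successive states, add up. *)
Lemma entry_Psi_op w x y :
  entry (Psi_op psi w) x y =
  unit_deformation (word_weight w x) * (y == braid_act w x)%:R.
Proof.
elim: w x => [|[i pos] w IHw] x.
  by rewrite entry1 /word_weight big_ord0 unit_deformation0 mul1r.
have /= gen z := entry_generator x z (i, pos).
rewrite /= (entry_mul_monomial_row _ _ gen).
by rewrite IHw mulrA -unit_deformationD word_weight_cons.
Qed.

Lemma Phi_fixed_states w :
  Phi psi w = \sum_(x | braid_act w x == x) unit_deformation (word_weight w x).
Proof.
rewrite /Phi trace_entry [RHS]big_mkcond /=; apply: eq_bigr => x _.
by rewrite entry_Psi_op eq_sym mulr_natr mulrb.
Qed.

End Strands.
End BraidOperator.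

(** * The closure of a braid *)

Section Closure.
Variables (Q : quandle) (A : finZmodType) (psi : Q -> Q -> A).
Variables (m : nat) (w : braid_word m).
Local Notation D := (braid_closure w).
Local Notation state := {ffun 'I_m.+1 -> Q}.
Implicit Types (l : {ffun node D -> Q}) (x : state) (t : 'I_(size w)).
Let letter t : 'I_m * bool := tnth (in_tuple w) t.

Definition row_colors l (n : 'I_(size w).+1) : state := [ffun j => l (n, j)].

Lemma next_level t j : next D (lift ord_max t, j) =
  (lift ord0 t, tperm (under_column (letter t)) (over_column (letter t)) j).
Proof.
rewrite permE /closure_step /level_perm liftK; congr (_, _).
  by apply: val_inj; rewrite /= /bump leqNgt ltn_ord add0n modn_small ?ltnS.
rewrite /under_column /over_column /letter.
by case: (tnth _ _).2; rewrite 1?tpermC.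
Qed.

Lemma next_last j : next D (ord_max, j) = (ord0, j).
Proof.
rewrite permE /closure_step /level_perm unlift_none perm1; congr (_, _).
by apply: val_inj; rewrite /= modnn.
Qed.

Lemma closure_under_codom (n : 'I_(size w).+1) j :
  ((n, j) \in codom (@under D)) =
  (if unlift ord_max n is Some t then j == under_column (letter t) else false).
Proof.
apply/codomP/idP=> [[t [-> ->]]|]; first by rewrite liftK.
by case: unliftP => // t -> /eqP ->; exists t.
Qed.

(** The colours of the edges arriving at level n form the state above the n-th
    letter, and the equations of an edge colouring say that each state is the
    braid_step of the previous one. The last level has no crossing: its equation
    closes the braid. *)
Lemma edge_coloring_closure l : edge_coloring l <->
  (forall t, row_colors l (lift ord0 t) =
             braid_step (row_colors l (lift ord_max t)) (letter t)) /\
  row_colors l ord0 = row_colors l ord_max.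
Proof.
have ou t := over_neq_under_column (letter t).
split=> [cl|[step wrap]].
  have [cu co] := edge_coloringP _ cl; split=> [t|].
    apply/ffunP=> j; rewrite !ffunE.
    have nextE i : l (next D (lift ord_max t, i)) = l (lift ord0 t,
        tperm (under_column (letter t)) (over_column (letter t)) i).
      by rewrite next_level.
    case: eqP => [->|/eqP jo]; first by rewrite -(cu t) nextE tpermL.
    case: eqP => [->|/eqP ju].
      by rewrite -(edge_coloring_over (D := D) t cl) nextE tpermR.
    rewrite -(co (lift ord_max t, j)); last first.
      by rewrite closure_under_codom liftK.
    by rewrite nextE tpermD 1?eq_sym.
  apply/ffunP=> j; rewrite !ffunE -(co (ord_max, j)) ?next_last //.
  by rewrite closure_under_codom unlift_none.
have stepE t j : l (lift ord0 t, j) =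
    braid_step (row_colors l (lift ord_max t)) (letter t) j.
  by rewrite -step ffunE.
apply/edge_coloringP; split=> [t|[n j]].
  by rewrite next_level tpermL stepE !ffunE eqxx.
rewrite closure_under_codom; case: unliftP => [t ->|-> _]; last first.
  by rewrite next_last; have /ffunP/(_ j) := wrap; rewrite !ffunE.
move=> ju; rewrite next_level stepE !ffunE.
case: tpermP => [ju'|->|/eqP _ /eqP jo]; first by rewrite ju' eqxx in ju.
  by rewrite eq_sym (negPf (ou t)) eqxx.
by rewrite (negPf jo) (negPf ju).
Qed.

Definition trace_colors x : {ffun node D -> Q} :=
  [ffun n : node D => braid_act (take (n.1 : 'I_(size w).+1) w) x n.2].

Lemma row_trace_colors x n :
  row_colors (trace_colors x) n = braid_act (take n w) x.
Proof. by apply/ffunP=> j; rewrite !ffunE. Qed.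

Lemma braid_act_take t x :
  braid_act (take t.+1 w) x = braid_step (braid_act (take t w) x) (letter t).
Proof.
rewrite /braid_act (take_nth (letter t)) // foldl_rcons.
by congr braid_step; apply/esym/tnth_nth.
Qed.

Lemma row_colors_act l n : edge_coloring l ->
  row_colors l n = braid_act (take n w) (row_colors l ord0).
Proof.
move=> /edge_coloring_closure[step _]; case: n => n; elim: n => [|n IHn] n_lt.
  by rewrite take0; congr row_colors; apply: val_inj.
pose t := Ordinal (n_lt : (n < size w)%N).
have -> : Ordinal n_lt = lift ord0 t by apply: val_inj.
rewrite step; apply: etrans (esym (braid_act_take t _)).
congr braid_step; rewrite -(IHn (ltnW n_lt)); congr row_colors; apply: val_inj.
by rewrite /= /bump leqNgt (n_lt : (n < size w)%N).
Qed.

(** A colouring of the closure is determined by its state at the top, which can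
    be any state that the braid carries to itself. *)
Lemma state_sum_closure : state_sum psi D = Phi psi w.
Proof.
rewrite Phi_fixed_states /state_sum.
rewrite (reindex_onto trace_colors (row_colors^~ ord0)) => [|l cl]; last first.
  by apply/ffunP=> -[n j]; rewrite ffunE -row_colors_act // ffunE.
apply: eq_big => [x|x _].
  rewrite row_trace_colors take0 eqxx andbT.
  apply/idP/eqP => [/edge_coloring_closure[_]|fx].
    by rewrite !row_trace_colors take0 take_size.
  apply/edge_coloring_closure; split=> [t|]; rewrite !row_trace_colors.
    have -> : lift ord_max t = t :> nat by rewrite /= /bump leqNgt ltn_ord.
    exact: braid_act_take.
  by rewrite take0 take_size.
congr unit_deformation; apply: eq_bigr => t _; rewrite /letter_weight !ffunE /=.
by rewrite /bump leqNgt ltn_ord.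
Qed.

End Closure.

(** * The trace condition *)

(** As q * q = q, the deformed operator has a nonzero diagonal entry at (q, q),
    and none at (q, y) for y other than q; its slope is a group element of Z[A],
    whereas the trace condition asks for slope zero. *)
Lemma not_enhanced_Yang_Baxter (Q : quandle) (A : finZmodType)
    (psi : Q -> Q -> A) (q : Q) :
  ~ enhanced_Yang_Baxter (Rtilde psi) 1 1 1%:M.
Proof.
case=> [T' [alpha' [beta' [_ _ _ + _]]]].
have -> : tensor_square (1%:M : 'M[dual (group_ring A)]_#|Q|) = 1%:M.
  apply: eq_entry => -[x y] [x' y']; rewrite entry_op_of !entry1 xpair_eqE.
  by rewrite -mulnb natrM.
rewrite mul1mx mulr1 scale1r => /(congr1 (fun M => entry M q q)).
rewrite entry_op_of entry1 eqxx (bigD1 q) //= big1 => [|y /negPf yq];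
  last by rewrite entry_Rtilde xpair_eqE /= eq_sym yq mulr0.
rewrite addr0 entry_Rtilde /= [turn _ _ _]qop_idem eqxx mulr1.
rewrite /unit_deformation -[X in X + _](rmorph1 (qpolyC _)).
move/(congr1 (fun z : dual (group_ring A) => (z : {poly _})`_1)).
rewrite coef1_dual /crossing_weight mul1r => /ffunP/(_ (psi q q)).
have -> : ((1 : dual (group_ring A)) : {poly group_ring A})`_1 = 0.
  by rewrite -[1](unit_deformation0) coef1_dual.
by rewrite !ffunE eqxx.
Qed.

Lemma erasure_inhabited (D D' : diagram) (S : {set node D}) :
  erasure D' S -> inhabited (node D) <-> inhabited (node D').
Proof.
move=> [f [g [_ fS _ _ [exit _]]]]; split=> -[x]; last by exists; apply: f x.
have [n xS] := exit x; move: xS; rewrite -fS => xf.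
by exists; apply: iinv xf.
Qed.

(** An erasure leaves at least one node on every strand. *)
Lemma link_equiv_inhabited (D D' : diagram) : link_equiv D D' ->
  inhabited (node D) <-> inhabited (node D').
Proof.
elim=> {D D'} [D D' [_ _ move_DD']|D|D D' _|D1 D2 D3 _ e12 _ e23].
- case: move_DD' => -[{}D {}D'] => [S _|c _|c c' _ _ _|] //.
  + exact: erasure_inhabited.
  + exact: erasure_inhabited.
  + exact: erasure_inhabited.
- by [].
- exact: iff_sym.
- exact: iff_trans e12 e23.
Qed.

Lemma state_sum_empty (Q : quandle) (A : finZmodType) (psi : Q -> Q -> A)
    (D : diagram) :
  (Q -> False) -> inhabited (node D) -> state_sum psi D = 0.
Proof. by move=> Q0 [x]; apply: big1 => l _; case: (Q0 (l x)). Qed.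

Theorem proposition5p9 (Q : quandle) (A : finZmodType) (psi : Q -> Q -> A)
  (hpsi : quandle_cocycle psi)
  (m : nat) (b : braid_word m) (D : diagram) (hD : planar D)
  (hK : R2_equiv (braid_closure b) D \/
        enhanced_Yang_Baxter (Rtilde psi) 1 1 1%:M /\
        link_equiv (braid_closure b) D) :
  Phi1 psi b = cocycle_sum D psi /\
  Phi psi b = qpolyC 'X^2 (Phi0 psi b) +
              hbar (group_ring A) * qpolyC 'X^2 (Phi1 psi b) /\
  Phi psi b = #|colorings D Q|%:R +
              hbar (group_ring A) * qpolyC 'X^2 (cocycle_sum D psi).
Proof.
have PhiE : Phi psi b = #|colorings D Q|%:R +
    hbar (group_ring A) * qpolyC 'X^2 (cocycle_sum D psi).
  rewrite -state_sum_diagram -state_sum_closure.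
  case: hK => [/state_sum_R2_equiv -> // | [enh equiv]].
  have Q0 (q : Q) : False := not_enhanced_Yang_Baxter q enh.
  have closure_inh : inhabited (node (braid_closure b)).
    by exists; exact: (ord0, ord0).
  rewrite !state_sum_empty //; exact/(link_equiv_inhabited equiv).
have Phi1E : Phi1 psi b = cocycle_sum D psi.
  by rewrite /Phi1 PhiE -(rmorph_nat (qpolyC 'X^2)) coef1_dual.
have Phi0E : Phi0 psi b = #|colorings D Q|%:R.
  by rewrite /Phi0 PhiE -(rmorph_nat (qpolyC 'X^2)) coef0_dual.
by rewrite Phi0E Phi1E PhiE rmorph_nat.
Qed.
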